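(* Let $Y=(y_1,\dots,y_N)$ be a tuple of $N\in\mathbb{N}$ distinct points in $\mathbb{R}^3$. Assume that $a\in\overline{\mathbb{C}}_-^N$ and $k\in\Sigma(a,Y)$ are such that $k$ belongs to the boundary $\mathrm{bd}\,\Sigma[\mathbb{F}_{\overline{\mathbb{C}}_-}]$. Let $D=D_a$ be the regularized determinant and $b\in\mathbb{C}^N$ the point associated with $a$ (see context). Then the following statements hold: (i) There exists $\xi\in[-\pi,\pi)$ such that $\partial_{\beta_j}D(b;k)$ belongs to the ray $e^{\mathrm{i}\xi}[0,+\infty)$ for all $j=1,\dots,N$. (ii) If $a_i\in\mathbb{C}_-$ for some $i$, then $\partial_{\beta_i}D(b;k)=0$ and, for arbitrary $c\in\overline{\mathbb{C}}_-$, one has $k\in\Sigma(a',Y)$ for the tuple $a'$ defined by $a'_i=c$ and $a'_j=a_j$ for $j\neq i$. (iii) There exists $a'\in\overline{\mathbb{R}}^N$ such that $k\in\Sigma(a',Y)$ and $n(a')=n_{\min}(k;\mathbb{F}_{\overline{\mathbb{C}}_-})$.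
   Context: Notation: $\mathbb{C}_-=\{z\in\mathbb{C}:\mathrm{Im}\,z<0\}$, $\overline{\mathbb{C}}=\mathbb{C}\cup\{\infty\}$, $\overline{\mathbb{R}}=\mathbb{R}\cup\{\infty\}$, $\overline{\mathbb{C}}_-=\mathbb{C}_-\cup\mathbb{R}\cup\{\infty\}$. For $x\in\mathbb{R}^3\setminus\{0\}$ and $z\in\mathbb{C}$ put $G_z(x)=\frac{e^{\mathrm{i}z|x|}}{4\pi|x|}$, and let $\widetilde G_z(x)=G_z(x)$ for $x\ne0$, $\widetilde G_z(0)=0$. For $\alpha\in\mathbb{C}^N$, $\Gamma_{\alpha,Y}(z)$ is the $N\times N$ matrix with entries $(\alpha_j-\frac{\mathrm{i}z}{4\pi})\delta_{jj'}-\widetilde G_z(y_j-y_{j'})$. For $\alpha\in\overline{\mathbb{C}}^N$ one sets $\det\Gamma_{\alpha,Y}(z):=\det\Gamma_{\widetilde\alpha,\widetilde Y}(z)$, where $\widetilde\alpha,\widetilde Y$ are obtained from $\alpha,Y$ by deleting the components with indices $j$ such that $\alpha_j=\infty$ (the determinant of the empty matrix is $1$). $\Sigma(\alpha,Y)\subset\mathbb{C}$ denotes the set of zeros of $\det\Gamma_{\alpha,Y}(\cdot)$. For $\mathbb{A}\subset\overline{\mathbb{C}}$, $\mathbb{F}_{\mathbb{A}}=\{H_\alpha:\alpha\in\mathbb{A}^N\}$ is the family of point-interaction Hamiltonians $H_\alpha=-\Delta_{\alpha,Y}$, and $\Sigma[\mathbb{F}_{\mathbb{A}}]=\bigcup_{\alpha\in\mathbb{A}^N}\Sigma(\alpha,Y)$.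 For $a\in\overline{\mathbb{C}}^N$, $n(a)$ is the number of components $a_j\ne\infty$; for $k\in\Sigma[\mathbb{F}_{\mathbb{A}}]$, $n_{\min}(k;\mathbb{F}_{\mathbb{A}})=\min\{n(\alpha): \alpha\in\mathbb{A}^N,\ k\in\Sigma(\alpha,Y)\}$. Regularized determinant: given $a\in\overline{\mathbb{C}}^N$, $D_a(\beta;z)=(-1)^{n(a)}\det[M_{jj'}]_{j,j'=1}^N$ for $\beta\in\mathbb{C}^N$, $z\in\mathbb{C}$, where row $j$ is $M_{jj'}=(\frac{\mathrm{i}z}{4\pi}-\beta_j)\delta_{jj'}+\widetilde G_z(y_j-y_{j'})$ if $a_j\neq\infty$, and $M_{jj'}=(1+\frac{\mathrm{i}z\beta_j}{4\pi})\delta_{jj'}+\beta_j\widetilde G_z(y_j-y_{j'})$ if $a_j=\infty$. (Here $\beta_j$ plays the role of $\alpha_j$ if $a_j\ne\infty$ and of $-1/\alpha_j$ if $a_j=\infty$.) The point $b\in\mathbb{C}^N$ is given by $b_j=a_j$ if $a_j\neq\infty$ and $b_j=0$ if $a_j=\infty$. *)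

(* Defs.v *)
From HB Require Import structures.
From mathcomp Require Import all_boot all_order all_algebra.
From mathcomp Require Import all_classical all_reals all_analysis.
From mathcomp Require Import complex.

Set Implicit Arguments.
Unset Strict Implicit.
Unset Printing Implicit Defensive.

Import Order.TTheory GRing.Theory Num.Theory.
Import numFieldNormedType.Exports.

Local Open Scope classical_set_scope.
Local Open Scope ring_scope.
Local Open Scope complex_scope.

Definition boundary (T : topologicalType) (A : set T) : set T :=
  closure A `\` interior A.

(* The library norm on ['rV_n] is the sup norm. *)
Definition euclidean_norm (R : realType) (n : nat) (x : 'rV[R]_n) : R :=
  Num.sqrt (\sum_i x 0 i ^+ 2).

(* The minimum of a nonempty set of natural numbers; junk on the empty set. *)
Definition nat_min (S : set nat) : nat :=
  xget 0%N [set n | S n /\ forall m, S m -> (n <= m)%N].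

Lemma nat_minP (S : set nat) : S !=set0 ->
  S (nat_min S) /\ forall m, S m -> (nat_min S <= m)%N.
Proof.
move=> [n Sn]; rewrite /nat_min; case: xgetP => [m _ //|noS]; exfalso.
have Sex : exists m, `[< S m >] by exists n; apply/asboolP.
apply: (noS (ex_minn Sex)); case: ex_minnP => p /asboolP Sp pmin.
by split=> // m Sm; apply: pmin; apply/asboolP.
Qed.

(* The extended complex plane: [None] is the point at infinity. *)
Definition cbar (R : realType) : Type := option R[i].

Section PointInteractions.
Context {R : realType}.

Definition cexp (z : R[i]) : R[i] :=
  (expR (complex.Re z))%:C *
  (cos (complex.Im z) +i* sin (complex.Im z)).

Definition cbar_lower : set (cbar R) :=
  [set x | if x is Some z then complex.Im z <= 0 else True].

Definition cbar_real : set (cbar R) :=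
  [set x | if x is Some z then complex.Im z = 0 else True].

(* The value at [x = 0] is the convention for [\widetilde G_z]; [G_z] itself is
   undefined there. *)
Definition Green (z : R[i]) (x : 'rV[R]_3) : R[i] :=
  if x == 0 then 0
  else cexp ('i * z * (euclidean_norm x)%:C) /
       (4 * pi * euclidean_norm x)%:C.

Definition iz4pi (z : R[i]) : R[i] := 'i * z / (4 * pi)%:C.

Definition Gamma (n : nat) (Y : 'I_n -> 'rV[R]_3) (alpha : 'I_n -> R[i])
    (z : R[i]) : 'M[R[i]]_n :=
  \matrix_(j, j') ((alpha j - iz4pi z) *+ (j == j') - Green z (Y j - Y j')).

Section Configuration.
Context {N : nat} (Y : 'I_N -> 'rV[R]_3).

Definition finite_idx (a : 'I_N -> cbar R) : {set 'I_N} :=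
  [set j | a j != None]%SET.

Definition nfin (a : 'I_N -> cbar R) : nat := #|finite_idx a|.

Definition fin_part (a : 'I_N -> cbar R) (j : 'I_N) : R[i] := odflt 0 (a j).

(* [enum_val] lists the indices of the finite components in increasing order,
   so this deletes the infinite components of [a] and the matching points. *)
Definition detGamma (a : 'I_N -> cbar R) (z : R[i]) : R[i] :=
  \det (Gamma (fun i : 'I_(nfin a) => Y (enum_val i))
              (fun i : 'I_(nfin a) => fin_part a (enum_val i)) z).

Definition Sigma (a : 'I_N -> cbar R) : set R[i]^o := [set z | detGamma a z = 0].

Definition SigmaF (A : set (cbar R)) : set R[i]^o :=
  \bigcup_(a in [set a : 'I_N -> cbar R | forall j, A (a j)]) Sigma a.

Definition nmin (k : R[i]) (A : set (cbar R)) : nat :=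
  nat_min [set nfin a | a in
    [set a : 'I_N -> cbar R | (forall j, A (a j)) /\ Sigma a k]].

Definition regdet (a : 'I_N -> cbar R) (beta : 'rV[R[i]]_N) (z : R[i]) : R[i] :=
  (-1) ^+ nfin a *
  \det (\matrix_(j, j')
    if a j is Some _ then
      (iz4pi z - beta 0 j) *+ (j == j') + Green z (Y j - Y j')
    else
      (1 + iz4pi z * beta 0 j) *+ (j == j')
        + beta 0 j * Green z (Y j - Y j')).

(* The complex partial derivative: scalars of ['rV[R[i]]_N] are complex. *)
Definition partial_regdet (a : 'I_N -> cbar R) (j : 'I_N)
    (beta : 'rV[R[i]]_N) (z : R[i]) : R[i] :=
  'D_(delta_mx 0 j) (fun beta' : 'rV[R[i]]_N => regdet a beta' z : R[i]^o) beta.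

Definition base_point (a : 'I_N -> cbar R) : 'rV[R[i]]_N := \row_j fin_part a j.

End Configuration.
End PointInteractions.

(* Main.v *)
Require Import Defs.
From mathcomp Require Import all_boot all_order all_algebra.
From mathcomp Require Import all_classical all_reals all_analysis.
From mathcomp Require Import complex.
From mathcomp Require Import ring lra.

(** Write [alpha_j = u_j / v_j] in projective coordinates. Up to a nonzero
    factor, [detGamma alpha z] is then the determinant of the matrix with rows
    [v_j (i z / 4 pi Id + G) - u_j Id], [pencil_det], which is defined for finite
    and infinite [alpha_j] alike ([pencil_det_eq0]) and is affine in each pair
    [(u_j, v_j)]. The regularized determinant is this function, up to sign, in
    the charts [(beta, 1)] and [(-1, beta)]; both charts send the closed lower
    half-plane to admissible parameters, because [-1/beta] preserves that
    half-plane. So a zero of [D(.; z)] with all [Im beta_j <= 0] puts [z] in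
    the union of the resonance sets, however far [beta] is from [b].

    Let [p_j] be the derivative of [D] at [b] in [beta_j]. Since no
    neighbourhood of [k] lies in that union, two situations cannot occur.
    - If [Im b_i < 0] and [p_i(k) <> 0], the affine equation in [beta_i] has
      for each [z] near [k] a root near [b_i], still in the lower half-plane
      ([affine_zero_near]). Hence [p_i(k) = 0], and then [D(.; k)] stays
      zero when the [i]-th coordinate alone is moved away from [b_i].
    - If [p_l(k) <> 0] and [p_j(k) / p_l(k)] is not a nonnegative real, the
      half-planes [p_j C_-] and [p_l C_-] together span the plane, so
      [D(b; z)] can be cancelled by moving [beta_j] and [beta_l] downwards
      ([biaffine_zero_near]). Hence all derivatives lie on the ray through
      [p_l(k)].

    For the minimal tuple, take a minimizer of [n] in the lower half-plane: a
    component off the real axis could be sent to infinity by the first point,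
    which would decrease [n]; so the minimizer is already real. *)

Set Implicit Arguments.
Unset Strict Implicit.
Unset Printing Implicit Defensive.

Import Order.TTheory GRing.Theory Num.Theory.
Import numFieldNormedType.Exports.

Local Open Scope classical_set_scope.
Local Open Scope ring_scope.
Local Open Scope complex_scope.

(** * Limits of complex functions *)

Section ComplexLimits.
Context {R : realType} {T : Type} {F : set_system T} {FF : Filter F}.
Implicit Types (f g : T -> R[i]) (l m : R[i]).

(** The algebra of [f] and [l] is that of [R[i]], and only the topology comes
    from the copy [R[i]^o]; keeping the two apart spares unification the
    comparison of both ring structures. *)
Definition cvgC f l : Prop := (f : T -> R[i]^o) @ F --> (l : R[i]^o).

Lemma cvgCD f g l m :
  cvgC f l -> cvgC g m -> cvgC (fun x => f x + g x) (l + m).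
Proof. exact: (@cvgD R[i] R[i]^o). Qed.

Lemma cvgCM f g l m :
  cvgC f l -> cvgC g m -> cvgC (fun x => f x * g x) (l * m).
Proof. exact: (@cvgM R[i]). Qed.

Lemma cvgCV f l : l != 0 -> cvgC f l -> cvgC (fun x => (f x)^-1) l^-1.
Proof. exact: (@cvgV R[i]). Qed.

Lemma cvgC_norm f l : cvgC f l -> cvgC (fun x => `|f x|) `|l|.
Proof. exact: (@cvg_norm R[i] R[i]^o). Qed.

Lemma cvgC_cst l : cvgC (fun=> l) l.
Proof. exact: cvg_cst. Qed.

Lemma cvgC_eq f g l : f =1 g -> cvgC f l -> cvgC g l.
Proof. by move=> /funext ->. Qed.

Lemma cvgC_bigop (op : R[i] -> R[i] -> R[i]) (x0 : R[i]) (I : Type)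
    (r : seq I) (f : I -> T -> R[i]) (l : I -> R[i]) :
  (forall f g l m, cvgC f l -> cvgC g m ->
     cvgC (fun x => op (f x) (g x)) (op l m)) ->
  (forall i, cvgC (f i) (l i)) ->
  cvgC (fun x => \big[op/x0]_(i <- r) f i x) (\big[op/x0]_(i <- r) l i).
Proof.
move=> opP fl; elim: r => [|i r IH].
  rewrite big_nil; apply: (@cvgC_eq (fun=> x0)) => [x|]; first by rewrite big_nil.
  exact: cvgC_cst.
rewrite big_cons; have := opP _ _ _ _ (fl i) IH; apply: cvgC_eq => x.
by rewrite big_cons.
Qed.

Lemma cvgC_det (n : nat) (M : T -> 'M[R[i]]_n) (A : 'M[R[i]]_n) :
  (forall i j, cvgC (fun x => M x i j) (A i j)) ->
  cvgC (fun x => \det (M x)) (\det A).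
Proof.
move=> MA; rewrite /determinant; apply: cvgC_bigop => [|s]; first exact: cvgCD.
apply: cvgCM; first exact: cvgC_cst.
by apply: cvgC_bigop => [|i]; first exact: cvgCM.
Qed.

Lemma normc_ge_Im (z : R[i]) : `|complex.Im z|%:C <= `|z|.
Proof.
case: z => x y; rewrite normc_def lecR /= -sqrtr_sqr.
by apply: ler_wsqrtr; rewrite lerDr sqr_ge0.
Qed.

Lemma cvgC_Re f l :
  cvgC f l -> complex.Re (f x) @[x --> F] --> complex.Re l.
Proof.
move=> /cvgrPdist_lt fl; apply/cvgrPdist_lt => e e0.
have e0' : 0 < e%:C by rewrite ltcR.
apply: filterS (fl _ e0') => x; rewrite -ltcR; apply: le_lt_trans.
by rewrite -raddfB /= normc_ge_Re.
Qed.

Lemma cvgC_Im f l :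
  cvgC f l -> complex.Im (f x) @[x --> F] --> complex.Im l.
Proof.
move=> /cvgrPdist_lt fl; apply/cvgrPdist_lt => e e0.
have e0' : 0 < e%:C by rewrite ltcR.
apply: filterS (fl _ e0') => x; rewrite -ltcR; apply: le_lt_trans.
by rewrite -raddfB /= normc_ge_Im.
Qed.

Lemma cvgC_real (f : T -> R) (l : R) :
  f x @[x --> F] --> l -> cvgC (fun x => (f x)%:C) l%:C.
Proof.
move=> /cvgrPdist_lt fl; apply/cvgrPdist_lt => -[e e'].
rewrite ltcE /= => /andP[/eqP -> e0].
apply: filterS (fl _ e0) => x.
by rewrite -raddfB /= normc_def /= expr0n addr0 sqrtr_sqr ltcR.
Qed.

Lemma cvgC_cexp f l : cvgC f l -> cvgC (fun x => cexp (f x)) (cexp l).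
Proof.
move=> fl; have re := cvgC_Re fl; have im := cvgC_Im fl.
have cexpE z : cexp z = (expR (complex.Re z))%:C *
    ((cos (complex.Im z))%:C + 'i%C * (sin (complex.Im z))%:C) :> R[i].
  by rewrite /cexp [X in _ * X]complexE.
rewrite cexpE; apply: (cvgC_eq (fun x => esym (cexpE (f x)))).
apply: cvgCM.
  by apply: cvgC_real; apply: continuous_cvg re; apply: continuous_expR.
apply: cvgCD.
  by apply: cvgC_real; apply: continuous_cvg im; apply: continuous_cos.
apply: cvgCM; first exact: cvgC_cst.
by apply: cvgC_real; apply: continuous_cvg im; apply: continuous_sin.
Qed.

Lemma cvgC_iz4pi f l : cvgC f l -> cvgC (fun x => iz4pi (f x)) (iz4pi l).
Proof.
move=> fl; apply: cvgCM; last exact: cvgC_cst.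
by apply: cvgCM fl; exact: cvgC_cst.
Qed.

Lemma cvgC_Green (y : 'rV[R]_3) f l :
  cvgC f l -> cvgC (fun x => Green (f x) y) (Green l y).
Proof.
move=> fl; rewrite /Green; case: (y == 0); first exact: cvgC_cst.
apply: cvgCM; last exact: cvgC_cst.
apply: cvgC_cexp; apply: cvgCM; last exact: cvgC_cst.
by apply: cvgCM fl; exact: cvgC_cst.
Qed.

End ComplexLimits.
Arguments cvgC {R T} F f l.

(** * Zeros that persist near a point *)

Section Solve.
Context {R : realType} (k : R[i]).
Let nk : set_system R[i]^o := nbhs (k : R[i]^o).

(** The root [- d z / p z] tends to [0] at [k], so that it cannot push [b] out
    of the open lower half-plane. *)
Lemma affine_zero_near (d p : R[i] -> R[i]) (b : R[i]) :
  cvgC nk d 0 -> cvgC nk p (p k) -> p k != 0 -> complex.Im b < 0 ->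
  \forall z \near (k : R[i]^o),
    exists2 e : R[i], complex.Im (b + e) <= 0 & d z + e * p z = 0.
Proof.
move=> d0 pk pk0 b0.
have nkF : Filter nk by apply: nbhs_filter.
have ek : cvgC nk (fun z => - 1 * (d z * (p z)^-1)) (- 1 * (0 * (p k)^-1)).
  by apply: cvgCM; [exact: cvgC_cst | apply: cvgCM d0 (cvgCV pk0 pk)].
have bk : cvgC nk (fun z => b + - 1 * (d z * (p z)^-1)) b.
  rewrite -[X in cvgC _ _ X]addr0 -[X in _ + X](mulr0 (- 1)).
  by rewrite -[X in _ * X](mul0r (p k)^-1); apply: cvgCD ek; exact: cvgC_cst.
have pn : complex.Re `|p z| @[z --> nk] --> complex.Re `|p k|.
  exact: (cvgC_Re (cvgC_norm pk)).
have pn0 : 0 < complex.Re `|p k|.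
  by have := pk0; rewrite -normr_gt0 ltcE => /andP[_].
near=> z; exists (- 1 * (d z * (p z)^-1)).
  by near: z; exact: cvgr_le _ (cvgC_Im bk) _ b0.
have pz : 0 < complex.Re `|p z| by near: z; exact: cvgr_gt _ pn _ pn0.
have pz0 : p z != 0 by apply: contraTneq pz => ->; rewrite normr0 /= ltxx.
by rewrite mulN1r mulNr divfK // subrr.
Unshelve. all: by end_near. Qed.

(** The half-turn [arg u \in [-pi, 0]] brings the argument of [w] into
    [(0, pi)] unless [w] lies on the nonnegative real axis; the rotations by
    [1], [-1] and [-i] suffice. *)
Lemma lower_rotation (w : R[i]) : ~~ (0 <= w) ->
  exists2 u : R[i], complex.Im u <= 0 & 0 < complex.Im (u * w).
Proof.
case: w => x y; rewrite lecE /= negb_and -ltNge.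
case: (ltgtP y 0) => [y0 _|y0 _|-> /=].
- by exists (-1); rewrite /= ?oppr0 ?mul0r ?addr0 ?mulN1r ?oppr_gt0.
- by exists 1; rewrite /= ?mul0r ?addr0 ?mul1r.
- by move=> /= x0; exists (- 'i%C); rewrite /= ?mulN1r; lra.
Qed.

(** Moving [e1] by a large multiple of [|d z|] in the direction of
    [lower_rotation] adds to the root [e2] a term with imaginary part
    [- t |d z| Im (u p / q)]; once [t] exceeds a bound for
    [|1 / q| / Im (u p / q)], this term dominates the uncontrolled term
    [- d z / q]. All sizes are proportional to [|d z|], so the coupling [r]
    only contributes a perturbation of [q] that vanishes at [k]. *)
Lemma biaffine_zero_near (d p q r : R[i] -> R[i]) :
  cvgC nk d 0 -> cvgC nk p (p k) -> cvgC nk q (q k) -> cvgC nk r (r k) ->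
  q k != 0 -> ~~ (0 <= p k / q k) ->
  \forall z \near (k : R[i]^o),
    exists e1, exists e2, [/\ complex.Im e1 <= 0, complex.Im e2 <= 0 &
      d z + e1 * p z + e2 * (q z + e1 * r z) = 0].
Proof.
move=> d0 pk qk rk qk0 /lower_rotation [u u0 m0].
set m := complex.Im _ in m0.
have nkF : Filter nk by apply: nbhs_filter.
(* The factor 2 and the summand 1 leave room for continuity: near [k],
   [Im (u p / s) >= m / 2] and [|1 / s| <= |1 / q| + 1]. *)
pose t := 2 / m * (complex.Re `|(q k)^-1| + 1).
pose e1 z := (t%:C * `|d z|) * u.
pose s z := q z + e1 z * r z.
have e1k : cvgC nk e1 0.
  rewrite -[0](mul0r u) -[X in X * u](mulr0 t%:C).
  rewrite -[X in _ * X * u](@normr0 _ R[i]^o).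
  apply: cvgCM; last exact: cvgC_cst.
  by apply: cvgCM (cvgC_norm d0); exact: cvgC_cst.
have sk : cvgC nk s (q k).
  by rewrite -[q k]addr0 -(mul0r (r k)); apply: cvgCD qk (cvgCM e1k rk).
have sn : complex.Re `|s z| @[z --> nk] --> complex.Re `|q k|.
  exact: (cvgC_Re (cvgC_norm sk)).
have sVn : complex.Re `|(s z)^-1| @[z --> nk] --> complex.Re `|(q k)^-1|.
  exact: (cvgC_Re (cvgC_norm (cvgCV qk0 sk))).
have gk : complex.Im (u * (p z * (s z)^-1)) @[z --> nk] --> m.
  apply: cvgC_Im; apply: cvgCM; [exact: cvgC_cst | exact: cvgCM pk (cvgCV qk0 sk)].
have qn0 : 0 < complex.Re `|q k|.
  by have := qk0; rewrite -normr_gt0 ltcE => /andP[_].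
have t0 : 0 < t.
  rewrite mulr_gt0 ?divr_gt0 // ltr_wpDl //.
  by have := normr_ge0 (q k)^-1; rewrite lecE => /andP[_].
near=> z.
have sz : 0 < complex.Re `|s z| by near: z; exact: cvgr_gt _ sn _ qn0.
have sz0 : s z != 0 by apply: contraTneq sz => ->; rewrite normr0 /= ltxx.
have sVz : complex.Re `|(s z)^-1| <= complex.Re `|(q k)^-1| + 1.
  by near: z; apply: cvgr_le _ sVn _ _; rewrite ltrDl.
have gz : m / 2 <= complex.Im (u * (p z * (s z)^-1)).
  by near: z; apply: cvgr_ge _ gk _ _; rewrite ltr_pdivrMr // ltr_pMr // ltr1n.
have [D dD] : exists D, `|d z| = D%:C.
  by rewrite normc_def; eexists.
have D0 : 0 <= D by have := normr_ge0 (d z); rewrite dD lecR.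
exists (e1 z), (- (d z + e1 z * p z) / s z); split.
- rewrite /e1 dD -rmorphM /=; case: (u) u0 => x y /= y0.
  by rewrite mul0r addr0 mulr_ge0_le0 // mulr_ge0 // ltW.
- have -> : - (d z + e1 z * p z) / s z =
      - (d z / s z) - (t * D)%:C * (u * (p z * (s z)^-1)).
    by rewrite /e1 dD [(t * D)%:C]rmorphM /=; ring.
  set g := u * _ in gz *.
  have Dle : - complex.Im (d z / s z) <= D * (complex.Re `|(q k)^-1| + 1).
    rewrite (le_trans (ler_norm _)) // normrN -lecR.
    rewrite (le_trans (normc_ge_Im _)) // normrM dD (rmorphM _ D) /=.
    by rewrite ler_wpM2l ?lecR // -[`|_|]RRe_real ?normr_real // lecR.
  have -> : complex.Im (- (d z / s z) - (t * D)%:C * g) =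
      - complex.Im (d z / s z) - t * D * complex.Im g.
    by rewrite raddfB raddfN; case: (g) => gx gy /=; rewrite mul0r addr0.
  rewrite (_ : D * _ = t * D * (m / 2)) in Dle; last first.
    by rewrite /t; field; rewrite gt_eqF.
  rewrite subr_le0 (le_trans Dle) // ler_wpM2l // mulr_ge0 // ltW //.
- by rewrite -/(s z) divfK // subrr.
Unshelve. all: by end_near. Qed.

End Solve.

(** * The determinant in projective coordinates *)

Definition upd {I : eqType} {T : Type} (h : I -> T) (j : I) (x : T) : I -> T :=
  fun l => if l == j then x else h l.

Section Pencil.
Context {R : realType} {N : nat} (Y : 'I_N -> 'rV[R]_3).
Implicit Types (h : 'I_N -> R[i] * R[i]) (a : 'I_N -> cbar R) (z : R[i]).

Definition pencil h z : 'M[R[i]]_N :=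
  \matrix_(j, j') (((h j).2 * iz4pi z - (h j).1) *+ (j == j')
                   + (h j).2 * Green z (Y j - Y j')).

Definition pencil_det h z : R[i] := \det (pencil h z).

Lemma pencil_det_affine h j (x y : R[i] * R[i]) (t : R[i]) z :
  pencil_det (upd h j (x.1 + t * y.1, x.2 + t * y.2)) z =
  pencil_det (upd h j x) z + t * pencil_det (upd h j y) z.
Proof.
rewrite -[X in _ = X + _]mul1r.
apply: (@determinant_multilinear _ _ _ _ _ j).
- apply/rowP => j'; rewrite !mxE /upd eqxx /=.
  by case: (j == j'); rewrite ?mulr1n ?mulr0n; ring.
- by apply/matrixP => i i'; rewrite !mxE /upd eq_sym (negPf (neq_lift _ _)).
- by apply/matrixP => i i'; rewrite !mxE /upd eq_sym (negPf (neq_lift _ _)).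
Qed.

Definition proj_coord (c : cbar R) (x : R[i] * R[i]) : Prop :=
  if c is Some u then x.2 != 0 /\ x.1 = u * x.2 else x.2 = 0 /\ x.1 != 0.

(** Kernel vectors, unlike determinants, restrict and extend along a subset of
    the indices without reindexing; this is how the determinant of size [N] is
    compared with the one of size [nfin a]. *)
Lemma det_kernelP (n : nat) (A : 'M[R[i]]_n) :
  \det A = 0 <->
  exists2 w : 'I_n -> R[i], (exists j, w j != 0) &
    forall j, \sum_j' A j j' * w j' = 0.
Proof.
rewrite -det_tr; split=> [/eqP /det0P [v v0 vA]|[w [j wj] wA]].
  exists (v 0); last first.
    move=> j; move/rowP/(_ j): vA; rewrite !mxE => vA; rewrite -[RHS]vA.
    by apply: eq_bigr => i _; rewrite mxE mulrC.
  by have /rV0Pn := v0.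
apply/eqP/det0P; exists (\row_j w j).
  by apply/rV0Pn; exists j; rewrite mxE.
apply/rowP => i; rewrite !mxE -[RHS](wA i).
by apply: eq_bigr => l _; rewrite !mxE mulrC.
Qed.

Lemma pencil_sum h z (w : 'I_N -> R[i]) j :
  \sum_j' pencil h z j j' * w j' =
  (h j).2 * (iz4pi z * w j + \sum_j' Green z (Y j - Y j') * w j')
  - (h j).1 * w j.
Proof.
under eq_bigr do rewrite mxE mulrDl mulrnAl -mulrA.
rewrite big_split /= -mulr_sumr (bigD1 j) //= eqxx mulr1n big1 ?addr0; first ring.
by move=> i /negPf; rewrite eq_sym => ->; rewrite mulr0n.
Qed.

Lemma Gamma_sum n (X : 'I_n -> 'rV[R]_3) (alpha : 'I_n -> R[i]) z
    (w : 'I_n -> R[i]) j :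
  \sum_j' Gamma X alpha z j j' * w j' =
  alpha j * w j - (iz4pi z * w j + \sum_j' Green z (X j - X j') * w j').
Proof.
under eq_bigr do rewrite mxE mulrBl mulrnAl.
rewrite sumrB (bigD1 j) //= eqxx mulr1n big1 ?addr0; first ring.
by move=> i /negPf; rewrite eq_sym => ->; rewrite mulr0n.
Qed.

Lemma sum_support (A : {set 'I_N}) (f w : 'I_N -> R[i]) :
  (forall j, j \notin A -> w j = 0) ->
  \sum_(j in A) f j * w j = \sum_j f j * w j.
Proof.
move=> w0; rewrite big_mkcond; apply: eq_bigr => j _.
by case: ifPn => // /w0 ->; rewrite mulr0.
Qed.

(** A row with [v_j = 0] says [u_j w_j = 0], so kernel vectors of the pencil
    vanish at the infinite components; the other rows are nonzero multiples of
    rows of [Gamma]. Hence both kernels correspond under restriction and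
    extension by zero. *)
Lemma pencil_det_eq0 a h z : (forall j, proj_coord (a j) (h j)) ->
  pencil_det h z = 0 <-> detGamma Y a z = 0.
Proof.
move=> ah; rewrite /pencil_det /detGamma !det_kernelP.
have fin0 j : (j \in finite_idx a) = (a j != None) by rewrite inE.
split=> -[w [i wi] wP].
- have w0 j : j \notin finite_idx a -> w j = 0.
    rewrite fin0 negbK => /eqP aj; have := wP j; have := ah j.
    rewrite pencil_sum aj /= => -[-> h0]; rewrite mul0r sub0r => /eqP.
    by rewrite oppr_eq0 mulf_eq0 (negPf h0) => /eqP.
  have ifin : i \in finite_idx a by apply: contra_neqT wi => /w0.
  exists (fun l => w (enum_val l)).
    by exists (enum_rank_in ifin i); rewrite enum_rankK_in.
  move=> l; rewrite Gamma_sum /=.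
  rewrite -(big_enum_val (fun j => Green z (Y (enum_val l) - Y j) * w j)) /=.
  have := wP (enum_val l); rewrite pencil_sum (sum_support _ w0).
  have : enum_val l \in finite_idx a by apply: enum_valP.
  rewrite fin0 /fin_part; have := ah (enum_val l).
  case: (a _) => //= u [v0 ->] _.
  rewrite [u * _]mulrC -(mulrA _ u) -mulrBr => /eqP; rewrite mulf_eq0 (negPf v0) /=.
  by move=> /eqP /(congr1 -%R); rewrite opprB oppr0.
(* The sum has one term or none: this is the extension of [w] by zero. *)
- pose v j := \sum_(l | enum_val l == j) w l.
  have vE l : v (enum_val l) = w l.
    rewrite /v (eq_bigl (pred1 l)) ?big_pred1_eq // => l'.
    by rewrite (inj_eq enum_val_inj).
  have v0 j : j \notin finite_idx a -> v j = 0.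
    move=> jn; rewrite /v big_pred0 // => l; apply: contraNF jn => /eqP <-.
    exact: enum_valP.
  exists v; first by exists (enum_val i); rewrite vE.
  move=> j; rewrite pencil_sum; have := ah j; case aj: (a j) => [u|] /=; last first.
    by case=> -> _; rewrite v0 ?fin0 ?aj // mul0r mulr0 subr0.
  case=> _ ->; have jfin : j \in finite_idx a by rewrite fin0 aj.
  have := wP (enum_rank_in jfin j); rewrite Gamma_sum /= -vE enum_rankK_in //.
  under eq_bigr do rewrite -vE.
  rewrite -(big_enum_val (fun l => Green z (Y j - Y l) * v l)) /= {1}/fin_part aj /=.
  rewrite (sum_support _ v0).
  by move=> E; rewrite [u * _]mulrC -(mulrA _ u) -mulrBr -opprB E oppr0 mulr0.
Qed.

End Pencil.

(** * The regularized determinant and its derivatives *)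

Section Charts.
Context {R : realType} {N : nat} (Y : 'I_N -> 'rV[R]_3).
Implicit Types (h : 'I_N -> R[i] * R[i]) (a : 'I_N -> cbar R) (z k : R[i]).

Lemma cvgC_pencil_det h k :
  cvgC (nbhs (k : R[i]^o)) (pencil_det Y h) (pencil_det Y h k).
Proof.
have kk : cvgC (nbhs (k : R[i]^o)) id k by exact: cvg_id.
apply: cvgC_det => i j.
have E : (fun z => pencil Y h z i j) = fun z =>
    ((h i).2 * iz4pi z - (h i).1) *+ (i == j) + (h i).2 * Green z (Y i - Y j).
  by apply/funext => z; rewrite mxE.
rewrite E mxE.
apply: cvgCD; last by apply: cvgCM; [exact: cvgC_cst | exact: cvgC_Green].
case: (i == j); last exact: cvgC_cst.
apply: cvgCD; last exact: cvgC_cst.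
by apply: cvgCM; [exact: cvgC_cst | exact: cvgC_iz4pi].
Qed.

(** Coordinates of [beta] when [c] is finite, and of [-1 / beta] when [c] is
    infinite. *)
Definition chart (c : cbar R) (b : R[i]) : R[i] * R[i] :=
  if c is Some _ then (b, 1) else (-1, b).

Definition chart_dir (c : cbar R) : R[i] * R[i] :=
  if c is Some _ then (1, 0) else (0, 1).

Definition charts a (b : 'I_N -> R[i]) : 'I_N -> R[i] * R[i] :=
  fun j => chart (a j) (b j).

Lemma regdetE a (b : 'rV[R[i]]_N) z :
  regdet Y a b z = (-1) ^+ nfin a * pencil_det Y (charts a (b 0)) z.
Proof.
rewrite /regdet /pencil_det; congr (_ * \det _).
apply/matrixP => i j; rewrite !mxE.
rewrite /charts; case: (a i) => [u|] /=; first by rewrite !mul1r.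
by rewrite opprK [1 + _]addrC [iz4pi z * _]mulrC.
Qed.

Lemma upd_id (I : eqType) (T : Type) (f : I -> T) j : upd f j (f j) = f.
Proof. by apply/funext => l; rewrite /upd; case: eqP => [->|]. Qed.

Lemma updC (I : eqType) (T : Type) (f : I -> T) j l x y : j != l ->
  upd (upd f j x) l y = upd (upd f l y) j x.
Proof.
move=> jl; apply/funext => i; rewrite /upd.
by case: (eqVneq i l) => [->|//]; rewrite eq_sym (negPf jl).
Qed.

Lemma charts_upd a b j c :
  charts a (upd b j c) = upd (charts a b) j (chart (a j) c).
Proof. by apply/funext => l; rewrite /charts /upd; case: eqP => [->|]. Qed.

Lemma chartD (c : cbar R) (b e : R[i]) :
  chart c (b + e) = ((chart c b).1 + e * (chart_dir c).1,
                     (chart c b).2 + e * (chart_dir c).2).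
Proof. by case: c => [u|] /=; rewrite ?mulr1 ?mulr0 ?addr0. Qed.

Lemma pencil_det_chart_affine h a j (b e : R[i]) z :
  pencil_det Y (upd h j (chart (a j) (b + e))) z =
  pencil_det Y (upd h j (chart (a j) b)) z +
  e * pencil_det Y (upd h j (chart_dir (a j))) z.
Proof. by rewrite chartD pencil_det_affine. Qed.

(** The derivative of the determinant in the [j]-th chart parameter. As a
    function of that parameter the determinant is affine, so this is again a
    determinant of the same kind, and its dependence on [z] is continuous. *)
Definition slope a b j : R[i] -> R[i] :=
  pencil_det Y (upd (charts a b) j (chart_dir (a j))).

Lemma pencil_det_move1 a b j e z :
  pencil_det Y (charts a (upd b j (b j + e))) z =
  pencil_det Y (charts a b) z + e * slope a b j z.
Proof.
rewrite charts_upd pencil_det_chart_affine; congr (_ + _).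
by rewrite -/(charts a b j) upd_id.
Qed.

Lemma pencil_det_move2 a b j l e1 e2 z : j != l ->
  pencil_det Y (charts a (upd (upd b j (b j + e1)) l (b l + e2))) z =
  pencil_det Y (charts a b) z + e1 * slope a b j z + e2 * (slope a b l z +
   e1 * pencil_det Y
     (upd (upd (charts a b) l (chart_dir (a l))) j (chart_dir (a j))) z).
Proof.
move=> jl; set b' := upd b j _.
have -> : b l = b' l by rewrite /b' /upd eq_sym (negPf jl).
rewrite pencil_det_move1 pencil_det_move1; congr (_ + _ * _).
rewrite /slope charts_upd updC //; set h := upd _ l _.
have hj : chart (a j) (b j) = h j by rewrite /h /upd (negPf jl).
by rewrite pencil_det_chart_affine hj upd_id.
Qed.

(** The difference quotients of an affine function are constant. *)
Lemma partial_regdetE a j k :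
  partial_regdet Y a j (base_point a) k =
  (-1) ^+ nfin a * slope a (fin_part a) j k.
Proof.
have baseE : base_point a 0 = fin_part a by apply/funext => l; rewrite mxE.
rewrite /partial_regdet /derive; apply: (@norm_lim_near_cst R[i] R[i]^o).
have h0 : \forall e \near (0 : R[i]^o)^', e != 0 by exact: nbhs_dnbhs_neq.
apply: filterS h0 => e e0 /=.
rewrite !regdetE.
have -> : (e *: delta_mx 0 j + base_point a) 0 =
    upd (fin_part a) j (fin_part a j + e) :> ('I_N -> R[i]).
  apply/funext => l; rewrite !mxE /upd eqxx /=.
  by case: (l == j) / eqP => [->|_]; rewrite ?mulr1 ?mulr0 ?add0r // addrC.
rewrite baseE -mulrBr pencil_det_move1 addrC addKr.
by rewrite -[LHS]/(e^-1 * _) mulrCA mulKf.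
Qed.

Lemma chart_lower (c : cbar R) (b : R[i]) : complex.Im b <= 0 ->
  exists c' : cbar R, cbar_lower c' /\ proj_coord c' (chart c b).
Proof.
case: c => [u|] /= b0; first by exists (Some b); rewrite /= mulr1 oner_eq0.
have [->|bn0] := eqVneq b 0.
  by exists None; rewrite /= oppr_eq0 oner_eq0.
exists (Some (- b^-1)); split; last by rewrite /= mulNr mulVf.
rewrite /=; case: b b0 {bn0} => x y /= y0; rewrite opprK.
by rewrite mulr_le0_ge0 // invr_ge0 addr_ge0 ?sqr_ge0.
Qed.

(** Both charts preserve the closed lower half-plane, as [- 1 / beta] has
    imaginary part [Im beta / |beta|^2]; so a zero found at any distance from
    the base point is a resonance of the family. *)
Lemma SigmaF_charts a b z : (forall j, complex.Im (b j) <= 0) ->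
  pencil_det Y (charts a b) z = 0 -> SigmaF Y cbar_lower z.
Proof.
move=> b0 h0; have /choice [c cP] := fun j => chart_lower (a j) (b0 j).
exists c; first by move=> j; have [] := cP j.
have cb j : proj_coord (c j) (charts a b j) by have [] := cP j.
exact/(pencil_det_eq0 Y z cb).
Qed.

Lemma charts_base a j : proj_coord (a j) (charts a (fin_part a) j).
Proof.
rewrite /charts /fin_part; case: (a j) => [u|] /=.
  by rewrite oner_eq0 mulr1.
by rewrite oppr_eq0 oner_eq0.
Qed.

Lemma polar_form (p : R[i]) : p != 0 ->
  exists2 xi : R, - pi <= xi < pi & p = cexp ('i * xi%:C) * `|p|.
Proof.
move=> p0; have n0 : 0 < complex.Re `|p|.
  by move: p0; rewrite -normr_gt0 ltcE => /andP[_].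
have nE : `|p| = (complex.Re `|p|)%:C by rewrite RRe_real ?normr_real.
set n := complex.Re `|p| in n0 nE.
have pn : complex.Re p ^+ 2 + complex.Im p ^+ 2 = n ^+ 2.
  by apply: complexI; rewrite add_Re2_Im2 nE rmorphXn.
set x := complex.Re p / n; set y := complex.Im p / n.
have xy : x ^+ 2 + y ^+ 2 = 1.
  by rewrite !expr_div_n -mulrDl pn divff // expf_neq0 ?gt_eqF.
have x1 : -1 <= x <= 1.
  rewrite -ler_norml -(@expr_le1 _ 2) // real_normK ?num_real // -xy.
  by rewrite lerDl sqr_ge0.
have cexpE t : cexp ('i * t%:C) = cos t +i* sin t.
  rewrite /cexp -complexiE /= !mul0r !mul1r subrr add0r expR0.
  by rewrite rmorph1 mul1r.
have pE : p = (x +i* y) * `|p|.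
  rewrite nE /x /y; case: (p) => u v /=; apply/eqP; rewrite eq_complex /=.
  have nn : n != 0 by rewrite gt_eqF.
  by rewrite !mulr0 subr0 add0r !divfK // !eqxx.
have sE : sin (acos x) = `|y|.
  by rewrite sin_acos // -xy addrAC subrr add0r sqrtr_sqr.
have [y0|y0] := leP y 0.
(* On the negative axis this case gives the argument [- pi], as the half-open
   interval demands. *)
- exists (- acos x).
    rewrite lerN2 acos_lepi //= (le_lt_trans _ (pi_gt0 R)) // oppr_le0.
    exact: acos_ge0.
  by rewrite cexpE cosN sinN acosK ?in_itv //= sE ler0_norm // opprK.
- exists (acos x).
    rewrite (le_trans _ (acos_ge0 x1)) ?oppr_le0 ?pi_ge0 //= acos_ltpi //.
    rewrite lt_neqAle eq_sym; case/andP: (x1) => -> ->; rewrite !andbT.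
    apply: contraTneq y0 => xN; move: xy; rewrite xN sqrrN expr1n => /eqP.
    by rewrite addrC -subr_eq0 addrK sqrf_eq0 => /eqP ->; rewrite ltxx.
  by rewrite cexpE acosK ?in_itv //= sE gtr0_norm.
Qed.

End Charts.
Arguments cvgC_pencil_det {R N} Y h k.

(** * Resonances that are not interior *)

Section Boundary.
Context {R : realType} {N : nat} (Y : 'I_N -> 'rV[R]_3) (k : R[i]).
Hypothesis kint : ~ interior (SigmaF Y cbar_lower) k.
Variable a : 'I_N -> cbar R.
Hypotheses (ha : forall j, cbar_lower (a j)) (hk : Sigma Y a k).
Let b := fin_part a.

Lemma pencil_det_charts_base : pencil_det Y (charts a b) k = 0.
Proof. exact/(pencil_det_eq0 Y k (charts_base a)). Qed.

Lemma fin_part_lower j : complex.Im (b j) <= 0.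
Proof. by rewrite /b /fin_part; have := ha j; case: (a j). Qed.

Lemma cvgC_pencil_det_base : cvgC (nbhs (k : R[i]^o)) (pencil_det Y (charts a b)) 0.
Proof.
by have := cvgC_pencil_det Y (charts a b) k; rewrite pencil_det_charts_base.
Qed.

Lemma slope_lower_eq0 i : complex.Im (b i) < 0 -> slope Y a b i k = 0.
Proof.
move=> bi; apply/eqP; apply: contra_notT kint => p0.
have p_k : cvgC (nbhs (k : R[i]^o)) (slope Y a b i) (slope Y a b i k).
  exact: cvgC_pencil_det.
have := affine_zero_near cvgC_pencil_det_base p_k p0 bi.
apply: filterS => z [e be de].
apply: (@SigmaF_charts _ _ _ a (upd b i (b i + e))); last first.
  by rewrite pencil_det_move1.
by move=> j; rewrite /upd; case: eqP => // _; exact: fin_part_lower.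
Qed.

Lemma slope_ratio_ge0 j l : slope Y a b l k != 0 ->
  0 <= slope Y a b j k / slope Y a b l k.
Proof.
move=> q0; have [->|jl] := eqVneq j l; first by rewrite divff ?ler01.
apply: contra_notT kint => w0.
have := biaffine_zero_near cvgC_pencil_det_base
  (cvgC_pencil_det Y _ k) (cvgC_pencil_det Y _ k)
  (cvgC_pencil_det Y
    (upd (upd (charts a b) l (chart_dir (a l))) j (chart_dir (a j))) k)
  q0 w0.
apply: filterS => z [e1 [e2 [e10 e20 ez]]].
apply: (@SigmaF_charts _ _ _ a (upd (upd b j (b j + e1)) l (b l + e2))).
  move=> i; rewrite /upd; do 2 (case: eqP => _; first
    by rewrite raddfD /= -[0]addr0 lerD // fin_part_lower).
  exact: fin_part_lower.
by rewrite pencil_det_move2.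
Qed.

Lemma partial_ray : exists2 xi : R, - pi <= xi < pi &
  forall j, exists2 r : R, 0 <= r &
    partial_regdet Y a j (base_point a) k = cexp ('i * xi%:C) * r%:C.
Proof.
have [[l l0]|all0] :=
    pselect (exists l, partial_regdet Y a l (base_point a) k != 0).
  have [xi xi_pi pE] := polar_form l0; exists xi => // j.
  have q0 : slope Y a b l k != 0.
    by apply: contraNneq l0; rewrite partial_regdetE => ->; rewrite mulr0.
  have w0 := slope_ratio_ge0 j q0.
  exists (complex.Re (`|partial_regdet Y a l (base_point a) k|
                      * (slope Y a b j k / slope Y a b l k))).
    by have := mulr_ge0 (normr_ge0 (partial_regdet Y a l (base_point a) k)) w0;
      rewrite lecE => /andP[].
  rewrite RRe_real; last by rewrite ger0_real // mulr_ge0.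
  by rewrite mulrA -pE !partial_regdetE -mulrA [slope _ _ _ l _ * _]mulrC divfK.
exists 0 => [|j]; first by rewrite oppr_le0 pi_ge0 pi_gt0.
exists 0 => //; rewrite mulr0; apply/eqP/negP => /negP j0; apply: all0.
by exists j.
Qed.

(** The slope in direction [i] is both the coefficient of [beta_i] and the
    determinant with [a_i] at infinity; its vanishing settles the finite and
    the infinite values of [c] together. *)
Lemma Sigma_free_coordinate i : (exists2 z, a i = Some z & complex.Im z < 0) ->
  partial_regdet Y a i (base_point a) k = 0 /\
  forall c, cbar_lower c -> Sigma Y (upd a i c) k.
Proof.
move=> [u ai u0]; have bi : b i = u by rewrite /b /fin_part ai.
have s0 : slope Y a b i k = 0 by apply: slope_lower_eq0; rewrite bi.
split; first by rewrite partial_regdetE s0 mulr0.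
move=> c _; case: c => [x|].
- have cP j : proj_coord (upd a i (Some x) j)
      (charts a (upd b i (b i + (x - b i))) j).
    rewrite charts_upd /upd; case: eqP => [_|_]; last exact: charts_base.
    by rewrite ai /= oner_eq0 subrKC mulr1.
  apply/(pencil_det_eq0 Y k cP).
  by rewrite pencil_det_move1 s0 mulr0 addr0 pencil_det_charts_base.
- have cP j : proj_coord (upd a i None j)
      (upd (charts a b) i (chart_dir (a i)) j).
    rewrite /upd; case: eqP => [_|_]; last exact: charts_base.
    by rewrite ai /= oner_eq0.
  by apply/(pencil_det_eq0 Y k cP).
Qed.

End Boundary.

Lemma nfin_upd_None {R : realType} {N : nat} (a : 'I_N -> cbar R) i :
  a i != None -> (nfin (upd a i None) < nfin a)%N.
Proof.
move=> ai; apply: proper_card; apply/properP; split.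
  by apply/fintype.subsetP => j; rewrite !inE /upd; case: (j == i).
by exists i; rewrite !inE // /upd eqxx.
Qed.

Theorem theorem6p1 (R : realType) (N : nat) (Y : 'I_N -> 'rV[R]_3)
    (Yinj : injective Y) (a : 'I_N -> cbar R) (k : R[i])
    (ha : forall j, cbar_lower (a j)) (hk : Sigma Y a k)
    (hbd : boundary (SigmaF Y cbar_lower) k) :
  [/\ (* i *)
      exists2 xi : R, - pi <= xi < pi &
        forall j : 'I_N, exists2 r : R, 0 <= r &
          partial_regdet Y a j (base_point a) k = cexp ('i * xi%:C) * r%:C,
      (* ii *)
      forall i : 'I_N,
        (exists2 z : R[i], a i = Some z & complex.Im z < 0) ->
        partial_regdet Y a i (base_point a) k = 0 /\
        forall c : cbar R, cbar_lower c ->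
          Sigma Y (fun j => if j == i then c else a j) k
    & (* iii *)
      exists a' : 'I_N -> cbar R,
        [/\ forall j, cbar_real (a' j), Sigma Y a' k
          & nfin a' = nmin Y k cbar_lower]].
Proof.
have [_ kint] := hbd; split.
- exact: partial_ray.
- by move=> i; apply: Sigma_free_coordinate.
- have [] := @nat_minP [set nfin a | a in
    [set a : 'I_N -> cbar R | (forall j, cbar_lower (a j)) /\ Sigma Y a k]].
    by exists (nfin a), a.
  rewrite -/(nmin Y k cbar_lower) => -[a' [a'low a'k] <-] a'min.
  exists a'; split=> // j; have := a'low j; rewrite /cbar_lower /cbar_real /=.
  case aj: (a' j) => [u|//]; rewrite le_eqVlt => /orP[/eqP //|u0].
  have [_ /(_ None I) a''k] :=
    Sigma_free_coordinate kint a'low a'k (ex_intro2 _ _ u aj u0).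
  have : (nfin a' <= nfin (upd a' j None))%N.
    apply: a'min; exists (upd a' j None) => //; split=> // l.
    by rewrite /upd; case: eqP => // _; exact: a'low.
  by rewrite leqNgt nfin_upd_None // aj.
Qed.
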